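(* Set $U=\{5,6,9,10,11\}$. The lattice $\mathsf{B}(3,3)$ satisfies every lattice-theoretical identity satisfied by $\mathsf{A}_U(12)$, and thus also every lattice-theoretical identity satisfied by the permutohedron $\mathsf{P}(12)$. In particular, $\mathsf{B}(3,3)$ satisfies every lattice-theoretical identity that is satisfied by every permutohedron $\mathsf{P}(n)$.
   Context: Notation: $[n]=\{1,\dots,n\}$ and $\mathcal{I}_n=\{(i,j)\in[n]\times[n] : i<j\}$. Permutohedra: a subset $\boldsymbol x\subseteq\mathcal{I}_n$ is closed if it is transitive as a binary relation, and clopen if both $\boldsymbol x$ and $\mathcal{I}_n\setminus\boldsymbol x$ are closed. The permutohedron $\mathsf{P}(n)$ is the set of all clopen subsets of $\mathcal{I}_n$, ordered by inclusion; it is a lattice. For a positive integer $n$ and $U\subseteq[n]$, $\mathsf{A}_U(n)$ is the set of all subsets $\boldsymbol{a}\subseteq\mathcal{I}_n$ that are transitive as binary relations and such that, whenever $1\le i<j<k\le n$ and $(i,k)\in\boldsymbol{a}$: $(i,j)\in\boldsymbol{a}$ if $j\in U$, and $(j,k)\in\boldsymbol{a}$ if $j\notin U$. It is ordered by inclusion and is a lattice. $\mathsf{B}(3,3)$ is the lattice obtained by doubling the join of $3$ atoms in the Boolean lattice with $6$ atoms: take the Boolean lattice $B$ with atoms $\boldsymbol a_1,\boldsymbol a_2,\boldsymbol a_3,\boldsymbol b_1,\boldsymbol b_2,\boldsymbol b_3$, put $\boldsymbol a=\boldsymbol a_1\vee\boldsymbol a_2\vee\boldsymbol a_3$, and let $\mathsf{B}(3,3)=B\cup\{\boldsymbol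 p\}$ with a new element $\boldsymbol p$, where the order extends that of $B$ and, for $x\in B$, $x<\boldsymbol p$ iff $x\le\boldsymbol a$, and $\boldsymbol p<x$ iff $\boldsymbol a<x$. A lattice-theoretical identity is a statement $u=v$ (or $u\le v$) for lattice terms $u,v$ built from variables with $\vee$ and $\wedge$; a lattice satisfies it if it holds for every assignment of elements of the lattice to the variables. *)

(* Defs.v *)
From HB Require Import structures.
From mathcomp Require Import all_boot all_order.

Set Implicit Arguments.
Unset Strict Implicit.
Unset Printing Implicit Defensive.

Import Order.TTheory.

Inductive lterm : Type :=
  | LVar of nat
  | LJoin of lterm & lterm
  | LMeet of lterm & lterm.

Fixpoint leval d (L : latticeType d) (v : nat -> L) (t : lterm) : L :=
  match t with
  | LVar i => v i
  | LJoin t1 t2 => Order.join (leval v t1) (leval v t2)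
  | LMeet t1 t2 => Order.meet (leval v t1) (leval v t2)
  end.

Inductive lidentity : Type :=
  | LEq of lterm & lterm
  | LLe of lterm & lterm.

Definition lholds d (L : latticeType d) (v : nat -> L) (e : lidentity) : Prop :=
  match e with
  | LEq s t => leval v s = leval v t
  | LLe s t => (leval v s <= leval v t)%O
  end.

Definition satisfies d (L : latticeType d) (e : lidentity) : Prop :=
  forall v : nat -> L, lholds v e.

(* Binary relations on [n] = {1, ..., n}: the integer k of [n] is represented
   by the element of 'I_n with value k - 1. *)

Section Relations.
Variable n : nat.
Implicit Types (x y z u : {set 'I_n * 'I_n}) (U : {set 'I_n}).

Definition incr_pairs : {set 'I_n * 'I_n} := [set p : 'I_n * 'I_n | p.1 < p.2].

Definition transitive_set x : bool :=
  [forall i, forall j, forall k,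
     ((i, j) \in x) && ((j, k) \in x) ==> ((i, k) \in x)].

Definition clopen x : bool :=
  [&& x \subset incr_pairs, transitive_set x &
      transitive_set (incr_pairs :\: x)].

(* Membership in A_U(n); U = [n] and U = empty give Tamari lattices. *)
Definition assoc_set U x : bool :=
  [&& x \subset incr_pairs, transitive_set x &
      [forall i : 'I_n, forall j : 'I_n, forall k : 'I_n,
         (i < j < k) && ((i, k) \in x) ==>
         (if j \in U then (i, j) \in x else (j, k) \in x)]].

Lemma transitive_setP x :
  reflect (forall i j k, (i, j) \in x -> (j, k) \in x -> (i, k) \in x)
          (transitive_set x).
Proof.
apply: (iffP forallP) => [H i j k ij jk|H i].
  by have /forallP/(_ j)/forallP/(_ k) := H i; rewrite ij jk.
by apply/forallP => j; apply/forallP => k; apply/implyP => /andP[]; apply: H.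
Qed.

Lemma assoc_setP U x :
  reflect [/\ x \subset incr_pairs, transitive_set x &
           forall i j k : 'I_n, i < j -> j < k -> (i, k) \in x ->
             if j \in U then (i, j) \in x else (j, k) \in x]
          (assoc_set U x).
Proof.
apply: (iffP and3P) => -[xI xt H]; split=> //.
  move=> i j k ij jk ik; have /forallP/(_ j)/forallP/(_ k) := forallP H i.
  by rewrite ij jk ik.
apply/forallP => i; apply/forallP => j; apply/forallP => k.
by apply/implyP => /andP[/andP[ij jk]]; apply: H.
Qed.

Lemma incr_pairs_trans : transitive_set incr_pairs.
Proof. by apply/transitive_setP => i j k; rewrite !inE; apply: ltn_trans. Qed.

Definition tclos u : {set 'I_n * 'I_n} :=
  \bigcap_(z | transitive_set z && (u \subset z)) z.

Lemma tclos_trans u : transitive_set (tclos u).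
Proof.
apply/transitive_setP => i j k /bigcapP ij /bigcapP jk.
apply/bigcapP => z Pz; case/andP: (Pz) => /transitive_setP zt _.
by apply: zt; [apply: ij|apply: jk].
Qed.

Lemma sub_tclos u : u \subset tclos u.
Proof. by apply/bigcapsP => z /andP[]. Qed.

Lemma tclos_min u z : transitive_set z -> u \subset z -> tclos u \subset z.
Proof. by move=> zt uz; apply: bigcap_inf; rewrite zt. Qed.

Lemma tclos_sub u z : transitive_set z -> (tclos u \subset z) = (u \subset z).
Proof.
move=> zt; apply/idP/idP; last exact: tclos_min.
exact/subset_trans/sub_tclos.
Qed.

Lemma co_transP u : transitive_set (incr_pairs :\: u) <->
  forall i j k : 'I_n, i < j -> j < k -> (i, k) \in u ->
    ((i, j) \in u) || ((j, k) \in u).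
Proof.
split=> [/transitive_setP ut i j k ij jk|H].
  apply: contraTT; rewrite negb_or => /andP[nij njk].
  by have := ut i j k; rewrite !inE /= nij njk ij jk => /(_ isT isT)/andP[].
apply/transitive_setP => i j k; rewrite !inE /=.
move=> /andP[nij ij] /andP[njk jk]; rewrite (ltn_trans ij jk) andbT.
by apply/negP => /(H _ _ _ ij jk); rewrite (negbTE nij) (negbTE njk).
Qed.

Lemma tclos_clopen x y : clopen x -> clopen y -> clopen (tclos (x :|: y)).
Proof.
move=> /and3P[xI _ /co_transP xc] /and3P[yI _ /co_transP yc].
set u := x :|: y; have uI : u \subset incr_pairs by rewrite subUset xI.
have TI : tclos u \subset incr_pairs by apply: tclos_min incr_pairs_trans uI.
have Tt := transitive_setP _ (tclos_trans u).
have sT := subsetP (sub_tclos u).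
apply/and3P; split; rewrite ?tclos_trans //; apply/co_transP.
pose T' := [set p : 'I_n * 'I_n | (p \in tclos u) &&
  [forall j : 'I_n, (p.1 < j < p.2) ==>
     ((p.1, j) \in tclos u) || ((j, p.2) \in tclos u)]].
suff /subsetP TT' : tclos u \subset T'.
  move=> i j k ij jk /TT'; rewrite inE /= => /andP[_ /forallP/(_ j)].
  by rewrite ij jk.
apply: tclos_min.
  apply/transitive_setP => i j k; rewrite !inE /=.
  move=> /andP[ij /forallP Hij] /andP[jk /forallP Hjk].
  rewrite (Tt _ _ _ ij jk) /=; apply/forallP => l.
  apply/implyP => /andP[il lk].
  have [lj|jl|/val_inj->] := ltngtP l j; last by rewrite ij.
    have := Hij l; rewrite il lj /= => /orP[->//|lj'].
    by rewrite (Tt _ _ _ lj' jk) orbT.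
  have := Hjk l; rewrite jl lk /= => /orP[jl'|->]; last by rewrite orbT.
  by rewrite (Tt _ _ _ ij jl').
apply/subsetP => -[i k] ik; rewrite inE sT //=.
apply/forallP => j; apply/implyP => /andP[ij jk].
have xT p : p \in x -> p \in tclos u by move=> px; apply: sT; rewrite inE px.
have yT p : p \in y -> p \in tclos u.
  by move=> py; apply: sT; rewrite inE py orbT.
move: ik; rewrite inE => /orP[/(xc _ _ _ ij jk)|/(yc _ _ _ ij jk)] /orP[h|h].
- by rewrite (xT _ h).
- by rewrite (xT _ h) orbT.
- by rewrite (yT _ h).
- by rewrite (yT _ h) orbT.
Qed.

Lemma clopenC x : clopen x -> clopen (incr_pairs :\: x).
Proof.
case/and3P=> xI xt xc; apply/and3P; split; rewrite ?subsetDl //.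
by rewrite setDDr setDv set0U (setIidPr xI).
Qed.

Lemma assoc_setI U x y : assoc_set U x -> assoc_set U y -> assoc_set U (x :&: y).
Proof.
move=> /assoc_setP[xI /transitive_setP xt xU] /assoc_setP[_ /transitive_setP yt yU].
apply/assoc_setP; split.
- by rewrite subIset ?xI.
- apply/transitive_setP => i j k; rewrite !inE => /andP[xij yij] /andP[xjk yjk].
  by rewrite (xt i j k) ?(yt i j k).
- move=> i j k ij jk; rewrite !inE => /andP[/(xU _ _ _ ij jk) + /(yU _ _ _ ij jk)].
  by case: ifP => _ -> ->.
Qed.

Lemma assoc_set_incr U : assoc_set U incr_pairs.
Proof.
apply/assoc_setP; split; rewrite ?incr_pairs_trans //.
by move=> i j k ij jk _; rewrite !inE /= ij jk if_same.
Qed.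

(* Least element of A_U(n) containing x, when x is a subset of incr_pairs. *)
Definition assoc_clos U x : {set 'I_n * 'I_n} :=
  incr_pairs :&: \bigcap_(z | assoc_set U z && (x \subset z)) z.

Lemma assoc_closP U x : assoc_set U (assoc_clos U x).
Proof.
rewrite /assoc_clos; elim/big_rec: _ => [|z y /andP[zU _] yU].
  by rewrite setIT assoc_set_incr.
by rewrite setICA; apply: assoc_setI.
Qed.

Lemma assoc_clos_sub U x z : x \subset incr_pairs -> assoc_set U z ->
  (assoc_clos U x \subset z) = (x \subset z).
Proof.
move=> xI zU; apply/idP/idP => [|xz].
  apply: subset_trans; rewrite subsetI xI.
  by apply/bigcapsP => w /andP[].
by rewrite subIset //; apply/orP; right; apply: bigcap_inf; rewrite zU.
Qed.

End Relations.

Record permutohedron (n : nat) : Type := Permutohedron {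
  perm_set :> {set 'I_n * 'I_n};
  perm_clopen : clopen perm_set
}.

HB.instance Definition _ n := [isSub for @perm_set n].
HB.instance Definition _ n := [Finite of permutohedron n by <:].

Section PermutohedronOrder.
Variable n : nat.
Implicit Types x y z : permutohedron n.

Definition perm_le x y : bool := perm_set x \subset perm_set y.

Lemma perm_le_refl : reflexive perm_le.
Proof. by move=> x; apply: subxx. Qed.

Lemma perm_le_anti : antisymmetric perm_le.
Proof. by move=> x y; rewrite /perm_le -eqEsubset => /eqP/val_inj. Qed.

Lemma perm_le_trans : transitive perm_le.
Proof. by move=> y x z; apply: subset_trans. Qed.

HB.instance Definition _ :=
  Order.Le_isPOrder.Build Order.SetSubsetOrder.subset_display (permutohedron n)
    perm_le_refl perm_le_anti perm_le_trans.

Definition perm_join x y : permutohedron n :=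
  Permutohedron (tclos_clopen (perm_clopen x) (perm_clopen y)).

Definition perm_compl x : permutohedron n :=
  Permutohedron (clopenC (perm_clopen x)).

(* Complementation is an order-reversing involution of P(n). *)
Definition perm_meet x y : permutohedron n :=
  perm_compl (perm_join (perm_compl x) (perm_compl y)).

Lemma perm_joinP x y z :
  perm_le (perm_join x y) z = perm_le x z && perm_le y z.
Proof.
by rewrite /perm_le tclos_sub ?subUset //; case/and3P: (perm_clopen z).
Qed.

Lemma perm_complK : involutive perm_compl.
Proof.
move=> x; apply: val_inj; rewrite /= setDDr setDv set0U.
by case/and3P: (perm_clopen x) => /setIidPr.
Qed.

Lemma perm_compl_le x y : perm_le x y -> perm_le (perm_compl y) (perm_compl x).
Proof. exact: setDS. Qed.

Lemma perm_le_compl x y : perm_le x (perm_compl y) = perm_le y (perm_compl x).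
Proof. by apply/idP/idP => /perm_compl_le; rewrite perm_complK. Qed.

Lemma perm_meetP x y z :
  perm_le x (perm_meet y z) = perm_le x y && perm_le x z.
Proof.
rewrite perm_le_compl perm_joinP -[in LHS]perm_le_compl perm_complK.
by congr (_ && _); rewrite perm_le_compl perm_complK.
Qed.

HB.instance Definition _ :=
  Order.POrder_MeetJoin_isLattice.Build Order.SetSubsetOrder.subset_display
    (permutohedron n) perm_meetP perm_joinP.

End PermutohedronOrder.

Record assoc_lattice (n : nat) (U : {set 'I_n}) : Type := AssocLattice {
  asc_set :> {set 'I_n * 'I_n};
  asc_assoc : assoc_set U asc_set
}.

HB.instance Definition _ n U := [isSub for @asc_set n U].
HB.instance Definition _ n (U : {set 'I_n}) := [Finite of assoc_lattice U by <:].

Section AssocOrder.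
Variables (n : nat) (U : {set 'I_n}).
Implicit Types x y z : assoc_lattice U.

Definition asc_le x y : bool := asc_set x \subset asc_set y.

Lemma asc_le_refl : reflexive asc_le.
Proof. by move=> x; apply: subxx. Qed.

Lemma asc_le_anti : antisymmetric asc_le.
Proof. by move=> x y; rewrite /asc_le -eqEsubset => /eqP/val_inj. Qed.

Lemma asc_le_trans : transitive asc_le.
Proof. by move=> y x z; apply: subset_trans. Qed.

HB.instance Definition _ :=
  Order.Le_isPOrder.Build Order.SetSubsetOrder.subset_display (assoc_lattice U)
    asc_le_refl asc_le_anti asc_le_trans.

Definition asc_meet x y : assoc_lattice U :=
  AssocLattice (assoc_setI (asc_assoc x) (asc_assoc y)).

Definition asc_join x y : assoc_lattice U :=
  AssocLattice (assoc_closP U (asc_set x :|: asc_set y)).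

Lemma asc_meetP x y z : asc_le x (asc_meet y z) = asc_le x y && asc_le x z.
Proof. exact: subsetI. Qed.

Lemma asc_joinP x y z : asc_le (asc_join x y) z = asc_le x z && asc_le y z.
Proof.
rewrite /asc_le assoc_clos_sub ?subUset ?(asc_assoc z) //.
by case/and3P: (asc_assoc x) => -> _ _; case/and3P: (asc_assoc y).
Qed.

HB.instance Definition _ :=
  Order.POrder_MeetJoin_isLattice.Build Order.SetSubsetOrder.subset_display
    (assoc_lattice U) asc_meetP asc_joinP.

End AssocOrder.

(* B(m, n): the Boolean lattice with atoms a_i = [set inl i] (i : 'I_m) and
   b_j = [set inr j] (j : 'I_n), where the join a of the a_i is doubled. The
   element x of the Boolean lattice is Some x, the new element p is None. *)

Definition doubled_boolean (m n : nat) : Type := option {set 'I_m + 'I_n}.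

HB.instance Definition _ m n :=
  Finite.copy (doubled_boolean m n) (option {set 'I_m + 'I_n}).

Fact doubled_display : Order.disp_t. Proof. exact: Order.Disp tt tt. Qed.

Section DoubledOrder.
Variables m n : nat.
Implicit Types x y z : doubled_boolean m n.

Definition join_a : {set 'I_m + 'I_n} := \bigcup_(i < m) [set inl i].

Definition dbl_le x y : bool :=
  match x, y with
  | Some x, Some y => x \subset y
  | Some x, None => x \subset join_a
  | None, Some y => join_a \proper y
  | None, None => true
  end.

Lemma dbl_le_refl : reflexive dbl_le.
Proof. by case=> [x|] //=. Qed.

Lemma dbl_le_anti : antisymmetric dbl_le.
Proof.
case=> [x|] [y|] //=.
- by rewrite -eqEsubset => /eqP->.
- by case/andP=> xa; rewrite properE xa andbF.
- by case/andP=> + ya; rewrite properE ya andbF.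
Qed.

Lemma dbl_le_trans : transitive dbl_le.
Proof.
case=> [y|] [x|] [z|] //=; first exact: subset_trans.
- exact: subset_trans.
- exact: proper_sub_trans.
- by move=> xa /proper_sub; apply: subset_trans.
Qed.

HB.instance Definition _ :=
  Order.Le_isPOrder.Build doubled_display (doubled_boolean m n)
    dbl_le_refl dbl_le_anti dbl_le_trans.

Definition dbl_join x y : doubled_boolean m n :=
  match x, y with
  | Some x, Some y => Some (x :|: y)
  | Some z, None | None, Some z =>
      if z \subset join_a then None else Some (join_a :|: z)
  | None, None => None
  end.

(* Two elements strictly above a whose intersection is a have p as meet. *)
Definition dbl_meet x y : doubled_boolean m n :=
  match x, y with
  | Some x, Some y =>
      if [&& join_a \proper x, join_a \proper y & x :&: y == join_a] then None
      else Some (x :&: y)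
  | Some z, None | None, Some z =>
      if join_a \proper z then None else Some (join_a :&: z)
  | None, None => None
  end.

Lemma dbl_joinP x y z : dbl_le (dbl_join x y) z = dbl_le x z && dbl_le y z.
Proof.
have aux (w : {set 'I_m + 'I_n}) :
    dbl_le (if w \subset join_a then None else Some (join_a :|: w)) z
    = dbl_le (Some w) z && dbl_le None z.
  case: z => [z|] /=; case: ifP => wa /=; rewrite ?andbT ?wa //.
  - apply/idP/andP => [az|[]//]; split=> //.
    exact: subset_trans wa (proper_sub az).
  - rewrite subUset andbC; apply: andb_id2l => wz.
    rewrite properE; case: (boolP (join_a \subset z)) => //= _.
    by apply/esym; apply: contraFN wa; apply: subset_trans wz.
  - by rewrite subUset wa andbF.
case: x y => [x|] [y|] /=.
- by case: z {aux} => [z|] /=; rewrite subUset.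
- exact: aux.
- by rewrite aux andbC.
- by rewrite andbb.
Qed.

Lemma dbl_meetP x y z : dbl_le x (dbl_meet y z) = dbl_le x y && dbl_le x z.
Proof.
have aux (w : {set 'I_m + 'I_n}) :
    dbl_le x (if join_a \proper w then None else Some (join_a :&: w))
    = dbl_le x (Some w) && dbl_le x None.
  case: x => [x|] /=; case: ifP => aw //=; last 1 first.
  - rewrite properE subsetI subxx /=.
    by rewrite subsetIl andbF.
  - apply/idP/andP => [xa|[]//]; split=> //.
    exact: subset_trans xa (proper_sub aw).
  - by rewrite subsetI andbC.
case: y z => [y|] [z|] /=.
- case: x {aux} => [x|]; case: ifP => /= [/and3P[ay az /eqP yz]|].
  + by rewrite -subsetI yz.
  + by rewrite subsetI.
  + by rewrite ay az.
  + case: (boolP (join_a \proper y)) => /= [ay|/negP nay _].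
      case: (boolP (join_a \proper z)) => /= [az yz|/negP naz _].
        rewrite properEneq eq_sym yz subsetI.
        by rewrite (proper_sub ay) (proper_sub az).
      by apply/negP => /proper_sub_trans/(_ (subsetIr _ _)).
    by apply/negP => /proper_sub_trans/(_ (subsetIl _ _)).
- exact: aux.
- by rewrite aux andbC.
- by rewrite andbb.
Qed.

HB.instance Definition _ :=
  Order.POrder_MeetJoin_isLattice.Build doubled_display (doubled_boolean m n)
    dbl_meetP dbl_joinP.

End DoubledOrder.

(* Main.v *)
(* Write a_i, b_j for the atoms of B(m, n) and c_i, d_j for the complementary
   coatoms; besides these, p is join-irreducible and a is meet-irreducible.
   Choose lo(x) in a lattice L for each join-irreducible x and up(y) for each
   meet-irreducible y, with lo(x) <= up(y) when x <= y,
   lo(p) <= \/_i lo(a_i) \/ lo(b_j) for all j, and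
   /\_j up(d_j) /\ up(c_i) <= up(a) for all i.  The pairs (l, z) such that
   lo(x) <= l for every x <= z and l <= up(y) for every y >= z form a sublattice
   of L x B(m, n).  As soon as lo(x) is never below up(y) unless x <= y, this
   sublattice is the graph of a homomorphism onto B(m, n), so that B(m, n)
   inherits the identities of L.  For L = A_U(12) such elements are exhibited
   from three tilings of the interval [1, 12].  Finally, A_U(n) is a sublattice
   of P(n): its members are clopen, and it is closed under intersection and
   under the transitive closure of unions. *)

Require Import Defs.
From HB Require Import structures.
From mathcomp Require Import all_boot all_order.

Set Implicit Arguments.
Unset Strict Implicit.
Unset Printing Implicit Defensive.

Import Order.TTheory.

Lemma satisfies_rel dL dM (L : latticeType dL) (M : latticeType dM)
    (R : L -> M -> Prop) (g : M -> L) :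
  (forall y, R (g y) y) ->
  (forall x x' y y', R x y -> R x' y' -> R (x `|` x')%O (y `|` y')%O) ->
  (forall x x' y y', R x y -> R x' y' -> R (x `&` x')%O (y `&` y')%O) ->
  (forall x x' y y', R x y -> R x' y' -> (x <= x')%O -> (y <= y')%O) ->
  forall e, satisfies L e -> satisfies M e.
Proof.
move=> Rg RU RI Rle e Le v.
have Rv t : R (leval (g \o v) t) (leval v t).
  by elim: t => [i|s Rs t Rt|s Rs t Rt] /=; [apply: Rg|apply: RU|apply: RI].
case: e Le => s t /(_ (g \o v)) /= Lst; last exact: Rle Lst.
by apply: le_anti; rewrite !(Rle _ _ _ _ (Rv _) (Rv _)) ?Lst.
Qed.

Section AssocInPermutohedron.
Variables (n : nat) (U : {set 'I_n}).

Lemma assoc_clopen x : assoc_set U x -> clopen x.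
Proof.
case/assoc_setP=> xI xt xU; apply/and3P; split=> //; apply/co_transP.
by move=> i j k ij jk /(xU _ _ _ ij jk); case: ifP => _ ->; rewrite ?orbT.
Qed.

Lemma tclos_assoc x y :
  assoc_set U x -> assoc_set U y -> assoc_set U (tclos (x :|: y)).
Proof.
move=> /assoc_setP[xI _ xU] /assoc_setP[yI _ yU].
set u := x :|: y; have uI : u \subset incr_pairs n by rewrite subUset xI.
have Tt := transitive_setP _ (tclos_trans u).
have sT := subsetP (sub_tclos u).
apply/assoc_setP; split.
- exact: tclos_min (incr_pairs_trans n) uI.
- exact: tclos_trans.
pose between (p : 'I_n * 'I_n) (j : 'I_n) :=
  if j \in U then (p.1, j) \in tclos u else (j, p.2) \in tclos u.
pose T' := [set p : 'I_n * 'I_n | (p \in tclos u) &&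
  [forall j : 'I_n, (p.1 < j < p.2) ==> between p j]].
suff /subsetP TT' : tclos u \subset T'.
  move=> i j k ij jk /TT'; rewrite inE /= => /andP[_ /forallP/(_ j)].
  by rewrite ij jk.
apply: tclos_min.
  apply/transitive_setP => i j k; rewrite !inE /=.
  move=> /andP[ij /forallP Hij] /andP[jk /forallP Hjk].
  rewrite (Tt _ _ _ ij jk) /=; apply/forallP => l.
  apply/implyP => /andP[il lk]; rewrite /between /=.
  have [lj|jl|/val_inj->] := ltngtP l j; last by rewrite ij jk if_same.
    have := Hij l; rewrite il lj /between /=; case: ifP => // _ lj'.
    exact: Tt lj' jk.
  have := Hjk l; rewrite jl lk /between /=; case: ifP => // _ jl'.
  exact: Tt ij jl'.
apply/subsetP => -[i k] ik; rewrite inE sT //=.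
apply/forallP => j; apply/implyP => /andP[ij jk]; rewrite /between /=.
move: ik; rewrite inE => /orP[/(xU _ _ _ ij jk)|/(yU _ _ _ ij jk)].
  by case: ifP => _ h; apply: sT; rewrite inE h.
by case: ifP => _ h; apply: sT; rewrite inE h orbT.
Qed.

Definition assoc_perm (x : assoc_lattice U) : permutohedron n :=
  Permutohedron (assoc_clopen (asc_assoc x)).

Lemma assoc_perm_le (x y : assoc_lattice U) :
  (assoc_perm x <= assoc_perm y)%O = (x <= y)%O.
Proof. by []. Qed.

Lemma assoc_permU (x y : assoc_lattice U) :
  assoc_perm (x `|` y)%O = (assoc_perm x `|` assoc_perm y)%O.
Proof.
apply: le_anti; rewrite leUx !assoc_perm_le leUl leUr !andbT.
rewrite -[(_ <= _)%O]/(assoc_clos U (x :|: y) \subset tclos (x :|: y)).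
rewrite assoc_clos_sub ?sub_tclos ?tclos_assoc ?asc_assoc //.
by rewrite subUset; case/and3P: (asc_assoc x) => -> _ _;
   case/and3P: (asc_assoc y).
Qed.

Lemma assoc_permI (x y : assoc_lattice U) :
  assoc_perm (x `&` y)%O = (assoc_perm x `&` assoc_perm y)%O.
Proof.
apply: le_anti; rewrite lexI !assoc_perm_le leIl leIr /=.
set z := (_ `&` _)%O; rewrite -[(_ <= _)%O]/(perm_set z \subset x :&: y).
have zx : (z <= assoc_perm x)%O by apply: leIl.
have zy : (z <= assoc_perm y)%O by apply: leIr.
by rewrite subsetI; apply/andP.
Qed.

Lemma satisfies_perm_assoc e :
  satisfies (permutohedron n) e -> satisfies (assoc_lattice U) e.
Proof.
apply: (@satisfies_rel _ _ _ _ (fun p x => p = assoc_perm x) assoc_perm) => //.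
- by move=> _ _ x y -> ->; rewrite assoc_permU.
- by move=> _ _ x y -> ->; rewrite assoc_permI.
- by move=> _ _ x y -> ->.
Qed.

End AssocInPermutohedron.

Section DoubledFromBounds.
Variables (m n : nat) (d : Order.disp_t) (L : bLatticeType d).
Variables (lo up : 'I_m + 'I_n -> L) (P Q : L).

Hypothesis lo_up : forall k k', k != k' -> (lo k <= up k')%O.
Hypothesis lo_nup : forall k, ~~ (lo k <= up k)%O.
Hypothesis loQ : forall i, (lo (inl i) <= Q)%O.
Hypothesis upP : forall j, (P <= up (inr j))%O.
Hypothesis P_join : forall j l,
  (forall i, lo (inl i) <= l)%O -> (lo (inr j) <= l)%O -> (P <= l)%O.
Hypothesis Q_meet : forall i l,
  (forall j, l <= up (inr j))%O -> (l <= up (inl i))%O -> (l <= Q)%O.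
Hypothesis PnQ : ~~ (P <= Q)%O.

Local Notation B := (doubled_boolean m n).
Local Notation a := (join_a m n).

Lemma join_aE k : (k \in a) = if k is inl _ then true else false.
Proof.
case: k => k; first by apply/bigcupP; exists k; rewrite ?inE.
by apply/bigcupP => -[i _]; rewrite inE.
Qed.

Lemma join_a_proper (X : {set 'I_m + 'I_n}) :
  reflect ((forall i, inl i \in X) /\ exists j, inr j \in X) (a \proper X).
Proof.
apply: (iffP properP) => [[/subsetP aX [[i|j]]]|[Xl [j Xj]]].
- by rewrite join_aE.
- by move=> Xj _; split; [move=> i; apply: aX; rewrite join_aE|exists j].
- split; first by apply/subsetP => -[i|j']; rewrite join_aE.
  by exists (inr j); rewrite ?join_aE.
Qed.

Lemma proper_join_a (X : {set 'I_m + 'I_n}) :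
  reflect ((forall j, inr j \notin X) /\ exists i, inl i \notin X)
          (X \proper a).
Proof.
apply: (iffP properP) => [[/subsetP Xa [[i|j]]]|[Xr [i Xi]]].
- by move=> _ Xi; split; [move=> j; apply/negP => /Xa|exists i];
     rewrite ?join_aE.
- by rewrite join_aE.
- split; last by exists (inl i); rewrite ?join_aE.
  by apply/subsetP => -[i'|j]; rewrite join_aE // (negPf (Xr j)).
Qed.

(* The homomorphism of B(m, n) onto the Boolean lattice that collapses a < p. *)
Definition dbl_supp (x : B) : {set 'I_m + 'I_n} := if x is Some X then X else a.

Lemma dbl_suppU (x y : B) :
  dbl_supp (x `|` y)%O = dbl_supp x :|: dbl_supp y.
Proof.
case: x y => [X|] [Y|] //=; rewrite -?[(_ `|` _)%O]/(dbl_join _ _) /=.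
- by case: ifP => [/setUidPr//|_]; rewrite setUC.
- by case: ifP => [/setUidPl|].
- by rewrite setUid.
Qed.

Lemma dbl_suppI (x y : B) :
  dbl_supp (x `&` y)%O = dbl_supp x :&: dbl_supp y.
Proof.
case: x y => [X|] [Y|] //=; rewrite -?[(_ `&` _)%O]/(dbl_meet _ _) /=.
- by case: ifP => [/and3P[_ _ /eqP]|].
- by case: ifP => [/proper_sub/setIidPr//|_]; rewrite setIC.
- by case: ifP => [/proper_sub/setIidPl|].
- by rewrite setIid.
Qed.

Lemma dbl_supp_le (x y : B) : dbl_supp x \subset dbl_supp y ->
  ~~ ((None <= x :> B) && (y <= Some a :> B))%O -> (x <= y)%O.
Proof.
rewrite -![(_ <= _)%O]/(dbl_le _ _).
by case: x y => [X|] [Y|] //= aY; rewrite properE aY.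
Qed.

Definition dbl_bounds (l : L) (x : B) : Prop :=
  [/\ forall k, k \in dbl_supp x -> (lo k <= l)%O,
      forall k, k \notin dbl_supp x -> (l <= up k)%O,
      (None <= x :> B)%O -> (P <= l)%O &
      (x <= Some a :> B)%O -> (l <= Q)%O].

Lemma dbl_bounds_ex (x : B) :
  dbl_bounds ((\join_(k in dbl_supp x) lo k) `|`
              (if x is None then P else \bot))%O x.
Proof.
have los k : k \in dbl_supp x -> (lo k <= \join_(k in dbl_supp x) lo k)%O.
  by move=> kx; apply: joins_sup.
split.
- by move=> k /los; apply: lexUl.
- move=> k kx; rewrite leUx; apply/andP; split.
    apply/joinsP => k' k'x; apply: lo_up.
    by apply: contraNneq kx => <-.
  case: x kx {los} => [X _|]; first exact: le0x.
  by case: k => [i|j]; rewrite join_aE.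
- case: x los => [X|] los; last by move=> _; apply: leUr.
  move=> /join_a_proper[Xl [j Xj]].
  by apply: (P_join (j := j)) => [i|]; apply/lexUl/los.
- rewrite -[(_ <= _)%O]/(dbl_le _ _).
  case: x {los} => [X|] /=; last by rewrite properxx.
  move=> Xa; rewrite leUx le0x andbT; apply/joinsP => k /(subsetP Xa).
  by case: k => [i|j] //; rewrite join_aE.
Qed.

Lemma dbl_boundsU l l' x y : dbl_bounds l x -> dbl_bounds l' y ->
  dbl_bounds (l `|` l')%O (x `|` y)%O.
Proof.
move=> [xlo xup xP xQ] [ylo yup yP yQ].
have xylo k : k \in dbl_supp (x `|` y)%O -> (lo k <= l `|` l')%O.
  rewrite dbl_suppU inE => /orP[/xlo|/ylo] h; [exact: lexUl|exact: lexUr].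
split=> //.
- move=> k; rewrite dbl_suppU inE negb_or => /andP[kx ky].
  by rewrite leUx xup ?yup.
- move=> pxy; have [/xP|npx] := boolP (None <= x :> B)%O; first exact: lexUl.
  have [/yP|npy] := boolP (None <= y :> B)%O; first exact: lexUr.
  case: x y pxy npx npy xylo {xlo xup xP xQ ylo yup yP yQ} => [X|] [Y|] //.
  move=> /join_a_proper[XYl [j XYj]] _ _ xylo.
  by apply: (P_join (j := j)) => [i|]; apply: xylo.
- by rewrite !leUx => /andP[/xQ-> /yQ].
Qed.

Lemma dbl_boundsI l l' x y : dbl_bounds l x -> dbl_bounds l' y ->
  dbl_bounds (l `&` l')%O (x `&` y)%O.
Proof.
move=> [xlo xup xP xQ] [ylo yup yP yQ].
have xyup k : k \notin dbl_supp (x `&` y)%O -> (l `&` l' <= up k)%O.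
  rewrite dbl_suppI inE negb_and => /orP[/xup|/yup] h;
    [exact: leIxl|exact: leIxr].
split=> //.
- move=> k; rewrite dbl_suppI inE => /andP[kx ky].
  by rewrite lexI xlo ?ylo.
- by rewrite !lexI => /andP[/xP-> /yP].
move=> xya; have [/xQ|nxa] := boolP (x <= Some a :> B)%O; first exact: leIxl.
have [/yQ|nya] := boolP (y <= Some a :> B)%O; first exact: leIxr.
have [[Xr [i Xi]]|nz] := proper_join_a (dbl_supp (x `&` y)%O).
  by apply: (Q_meet (i := i)) => [j|]; apply: xyup.
have za : dbl_supp (x `&` y)%O = a.
  apply/eqP; apply: contra_notT nz => /[dup]/negPf nza _.
  apply/proper_join_a; rewrite properEneq nza.
  case: (x `&` y)%O xya => [Z|] //.
  by rewrite -[(_ <= _)%O]/(a \proper a) properxx.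
exfalso; move: nxa nya xya za; rewrite dbl_suppI.
rewrite -![(_ <= _)%O]/(dbl_le _ _) -[(x `&` y)%O]/(dbl_meet x y).
case: x y {xlo xup xP xQ ylo yup yP yQ xyup nz} => [X|] [Y|] /=.
- move=> nXa nYa + za; case: ifP => /= [|/negP[]]; first by rewrite properxx.
  by rewrite za eqxx !properE nXa nYa !andbT -subsetI za.
- move=> nXa _ + za; case: ifP => /= [|/negP[]]; first by rewrite properxx.
  by rewrite properE nXa -za subsetIl.
- move=> _ nYa + za; case: ifP => /= [|/negP[]]; first by rewrite properxx.
  by rewrite properE nYa -za subsetIr.
- by rewrite properxx.
Qed.

Lemma dbl_bounds_le l l' x y : dbl_bounds l x -> dbl_bounds l' y ->
  (l <= l')%O -> (x <= y)%O.
Proof.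
move=> [xlo _ xP _] [_ yup _ yQ] ll'; apply: dbl_supp_le.
  apply/subsetP => k /xlo lol; apply: contraTT (lo_nup k) => /yup l'up.
  by rewrite negbK (le_trans lol) ?(le_trans ll').
apply: contra PnQ => /andP[/xP Pl /yQ l'Q].
by rewrite (le_trans Pl) ?(le_trans ll').
Qed.

Lemma satisfies_doubled e : satisfies L e -> satisfies B e.
Proof.
exact: (satisfies_rel dbl_bounds_ex dbl_boundsU dbl_boundsI dbl_bounds_le).
Qed.

End DoubledFromBounds.

Section AssocBottom.
Variables (n : nat) (U : {set 'I_n}).

Lemma assoc_set0 : assoc_set U set0.
Proof.
apply/assoc_setP; split; rewrite ?sub0set //; last by move=> i j k; rewrite inE.
by apply/transitive_setP => i j k; rewrite inE.
Qed.

Definition assoc_bot : assoc_lattice U := AssocLattice assoc_set0.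

Lemma assoc_bot_le (x : assoc_lattice U) : (assoc_bot <= x)%O.
Proof. exact: sub0set. Qed.

HB.instance Definition _ :=
  Order.hasBottom.Build Order.SetSubsetOrder.subset_display (assoc_lattice U)
    assoc_bot_le.

End AssocBottom.

(* Here u lists U, and lists of pairs are 1-based, as in [n] = {1, ..., n}. *)
Section PairLists.
Variables (n : nat) (u : seq nat).
Implicit Types (s t : seq (nat * nat)).

Definition pair_set s : {set 'I_n * 'I_n} :=
  [set p : 'I_n * 'I_n | (p.1.+1, p.2.+1) \in s].

Definition chain_step s : seq (nat * nat) :=
  [seq p <- [seq (i, k) | i <- iota 1 n, k <- iota 1 n] | (p \in s) ||
     has (fun j => ((p.1, j) \in s) && ((j, p.2) \in s)) (iota 1 n)].

Lemma chain_step_sub (z : {set 'I_n * 'I_n}) s : transitive_set z ->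
  pair_set s \subset z -> pair_set (chain_step s) \subset z.
Proof.
move=> /transitive_setP zt /subsetP sz; apply/subsetP => -[i k].
rewrite inE mem_filter /= => /andP[+ _] => /orP[h|/hasP[j + /andP[ij jk]]].
  by apply: sz; rewrite inE.
rewrite mem_iota => /andP[]; case: j ij jk => // j ij jk _; rewrite ltnS => jn.
by apply: (zt i (Ordinal jn)); apply: sz; rewrite inE.
Qed.

Lemma iter_chain_step_sub k (z : {set 'I_n * 'I_n}) s : transitive_set z ->
  pair_set s \subset z -> pair_set (iter k chain_step s) \subset z.
Proof. by move=> zt sz; elim: k => //= k; apply: chain_step_sub. Qed.

Definition assoc_list s : bool :=
  all (fun p => [&& p.1 < p.2,
    all (fun q => (p.2 == q.1) ==> ((p.1, q.2) \in s)) s &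
    all (fun j => (p.1 < j < p.2) ==>
      if j \in u then (p.1, j) \in s else (j, p.2) \in s) (iota 1 n)]) s.

Lemma assoc_listP s :
  assoc_list s -> assoc_set [set i : 'I_n | i.+1 \in u] (pair_set s).
Proof.
move=> /allP sP; apply/assoc_setP; split.
- by apply/subsetP => -[i j]; rewrite !inE => /sP/and3P[].
- apply/transitive_setP => i j k; rewrite !inE /=.
  by move=> /sP/and3P[_ /allP ijP _] /ijP; rewrite eqxx.
- move=> i j k ij jk; rewrite !inE /= => /sP/and3P[_ _ /allP/(_ j.+1)].
  by rewrite mem_iota /= !ltnS ij jk ltn_ord; apply.
Qed.

(* The least element of A_U(n) containing the pair p. *)
Definition tile (p : nat * nat) : seq (nat * nat) :=
  [seq q <- [seq (i, k) | i <- iota 1 n, k <- iota 1 n] |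
     [&& p.1 <= q.1 < q.2, q.2 <= p.2, (q.1 == p.1) || (q.1 \notin u) &
         (q.2 == p.2) || (q.2 \in u)]].

(* The bottom element when [assoc_list s] fails. *)
Definition assoc_of s : assoc_lattice [set i : 'I_n | i.+1 \in u] :=
  insubd (assoc_bot _) (pair_set s).

Lemma assoc_ofE s : assoc_list s -> asc_set (assoc_of s) = pair_set s.
Proof. by move=> sP; apply: insubdK; apply: assoc_listP. Qed.

Lemma assoc_of_le s t : assoc_list s -> assoc_list t -> all (mem t) s ->
  (assoc_of s <= assoc_of t)%O.
Proof.
move=> sP tP /allP st; rewrite -[(_ <= _)%O]/(asc_set _ \subset asc_set _).
by rewrite !assoc_ofE //; apply/subsetP => p; rewrite !inE => /st.
Qed.

Definition list_nle s t : bool :=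
  has (fun p => [&& p.1 \in iota 1 n, p.2 \in iota 1 n & p \notin t]) s.

Lemma assoc_of_nle s t : assoc_list s -> assoc_list t -> list_nle s t ->
  ~~ (assoc_of s <= assoc_of t)%O.
Proof.
move=> sP tP /hasP[[[|i] [|j]] ps]; rewrite !mem_iota /= ?andbF //= !ltnS.
move=> /and3P[ni nj pt]; rewrite -[(_ <= _)%O]/(asc_set _ \subset asc_set _).
by rewrite !assoc_ofE //; apply/subsetPn; exists (Ordinal ni, Ordinal nj);
   rewrite inE.
Qed.

End PairLists.

Section Certificate.
Variables (N : nat) (u : seq nat) (m n : nat).
Variables (lo up : nat -> seq (nat * nat)) (P Q : seq (nat * nat)).

Let chains s := iter N (chain_step N) s.

(* Index i < m stands for a_i and index m + j, with j < n, for b_j. *)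
Definition doubled_certificate : bool :=
  [&& all (fun k => assoc_list N u (lo k) && assoc_list N u (up k))
        (iota 0 (m + n)),
      assoc_list N u P && assoc_list N u Q,
      all (fun k => all (fun k' =>
        if k == k' then list_nle N (lo k) (up k) else all (mem (up k')) (lo k))
        (iota 0 (m + n))) (iota 0 (m + n)),
      all (fun i => all (mem Q) (lo i)) (iota 0 m),
      all (fun j => all (mem (up j)) P) (iota m n),
      all (fun j => all (mem (chains
        (flatten [seq lo i | i <- iota 0 m] ++ lo j))) P) (iota m n),
      all (fun i => all (fun p =>
        all (fun j => p \in up j) (iota m n) ==> (p \in Q)) (up i))
        (iota 0 m) &
      list_nle N P Q].

Let index (k : 'I_m + 'I_n) : nat :=
  match k with inl i => i | inr j => m + j end.

Let index_iota k : index k \in iota 0 (m + n).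
Proof.
rewrite mem_iota; case: k => k /=; last by rewrite add0n ltn_add2l.
exact: leq_trans (ltn_ord k) (leq_addr _ _).
Qed.

Let index_inj : injective index.
Proof.
move=> [i|j] [i'|j'] /=.
- by move=> /val_inj->.
- by move=> ij; have := ltn_ord i; rewrite ij ltnNge leq_addr.
- by move=> ij; have := ltn_ord i'; rewrite -ij ltnNge leq_addr.
- by move/addnI/val_inj->.
Qed.

Lemma satisfies_certificate e : doubled_certificate ->
  satisfies (assoc_lattice [set i : 'I_N | i.+1 \in u]) e ->
  satisfies (doubled_boolean m n) e.
Proof.
case/and5P=> loupA /andP[PA QA] /allP lo_up /allP loQ.
case/and4P=> /allP upP /allP P_join /allP Q_meet PnQ.
have loA k : assoc_list N u (lo (index k)).
  by have /andP[] := allP loupA _ (index_iota k).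
have upA k : assoc_list N u (up (index k)).
  by have /andP[] := allP loupA _ (index_iota k).
have {}lo_up k k' := allP (lo_up _ (index_iota k)) _ (index_iota k').
have inl_iota (i : 'I_m) : (i : nat) \in iota 0 m by rewrite mem_iota /=.
have inr_iota (j : 'I_n) : m + j \in iota m n.
  by rewrite mem_iota leq_addr ltn_add2l /=.
apply: (@satisfies_doubled _ _ _ _
  (fun k => assoc_of N u (lo (index k))) (fun k => assoc_of N u (up (index k)))
  (assoc_of N u P) (assoc_of N u Q)).
- move=> k k' kk'; apply: assoc_of_le => //.
  by have := lo_up k k'; rewrite (inj_eq index_inj) (negPf kk').
- by move=> k; apply: assoc_of_nle => //; have := lo_up k k; rewrite eqxx.
- by move=> i; apply: assoc_of_le (loA (inl i)) QA (loQ _ (inl_iota i)).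
- by move=> j; apply: assoc_of_le PA (upA (inr j)) (upP _ (inr_iota j)).
- move=> j l lol lobl; case/and3P: (asc_assoc l) => _ lt _.
  have sub k p : (assoc_of N u (lo (index k)) <= l)%O ->
      p \in pair_set N (lo (index k)) -> p \in asc_set l.
    rewrite -[(_ <= _)%O]/(asc_set _ \subset _) assoc_ofE //.
    by move/subsetP; apply.
  rewrite -[(_ <= _)%O]/(asc_set _ \subset _) assoc_ofE //.
  have /allP Pj := P_join _ (inr_iota j).
  apply/subsetP => p; rewrite inE => /Pj pj.
  apply: (subsetP (iter_chain_step_sub N lt _)); last by rewrite inE; apply: pj.
  apply/subsetP => q; rewrite inE mem_cat => /orP[|qj]; last first.
    by apply: (sub (inr j)) => //; rewrite inE.
  move=> /flatten_mapP[i]; rewrite mem_iota => /= ltim qi.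
  by apply: (sub (inl (Ordinal ltim))) => //; rewrite inE.
- move=> i l lupd lupc.
  have sub k p : (l <= assoc_of N u (up (index k)))%O -> p \in asc_set l ->
      (p.1.+1, p.2.+1) \in up (index k).
    rewrite -[(_ <= _)%O]/(_ \subset asc_set _) assoc_ofE //.
    by move=> /subsetP/(_ p)/[apply]; rewrite inE.
  rewrite -[(_ <= _)%O]/(_ \subset asc_set _) assoc_ofE //.
  apply/subsetP => p pl; rewrite inE.
  have /allP/(_ _ (sub _ _ lupc pl))/implyP := Q_meet _ (inl_iota i).
  apply; apply/allP => j; rewrite mem_iota => /andP[mj jmn].
  have ltj : j - m < n by rewrite ltn_subLR.
  by have := sub _ _ (lupd (Ordinal ltj)) pl; rewrite /= subnKC.
- exact: assoc_of_nle.
Qed.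

End Certificate.

(* The tiles labelled a_1, a_2, a_3, b_1, b_2, b_3, found by computer search in
   three tilings of [1, 12], each using every a_i and a single b_j:
   1 -b1- 2 -a1- 3 -a2- 4 -a3- 8 -a1- 12,
   1 -a1- 5 -a2- 6 -b2- 7 -a3- 8 -a1- 12,
   1 -a1- 5 -a2- 9 -a1- 10 -a3- 11 -b3- 12. *)
Definition witness_tiles : seq (seq (nat * nat)) :=
  [:: [:: (2, 3); (8, 12); (1, 5); (9, 10)]; [:: (3, 4); (5, 6); (5, 9)];
      [:: (4, 8); (7, 8); (10, 11)];
      [:: (1, 2)]; [:: (6, 7)]; [:: (11, 12)]].

(* Each step doubles the length of the chains taken into account, and chains in
   [1, 12] have at most 11 <= 2 ^ 4 links. *)
Definition tiles_join s : seq (nat * nat) :=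
  iter 4 (chain_step 12)
    (flatten [seq tile 12 [:: 5; 6; 9; 10; 11] p | p <- s]).

Definition witness_lo : seq (seq (nat * nat)) :=
  Eval vm_compute in [seq tiles_join s | s <- witness_tiles].

Definition witness_up : seq (seq (nat * nat)) :=
  Eval vm_compute in
  [seq tiles_join (flatten
     [seq nth [::] witness_tiles k' | k' <- iota 0 6 & k' != k]) | k <- iota 0 6].

Definition witness_meet i : seq (nat * nat) :=
  [seq p <- nth [::] witness_up i |
     all (fun j => p \in nth [::] witness_up j) (iota 3 3)].

Definition witness_Q : seq (nat * nat) :=
  Eval vm_compute in
  iter 4 (chain_step 12)
    (flatten (take 3 witness_lo) ++ flatten [seq witness_meet i | i <- iota 0 3]).

Lemma witness_certificate :
  doubled_certificate 12 [:: 5; 6; 9; 10; 11] 3 3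
    (nth [::] witness_lo) (nth [::] witness_up) (tiles_join [:: (1, 12)])
    witness_Q.
Proof. by vm_compute. Qed.

Theorem corollary12p2 :
  let U : {set 'I_12} := [set i : 'I_12 | i.+1 \in [:: 5; 6; 9; 10; 11]] in
  [/\ forall e : lidentity,
        satisfies (assoc_lattice U) e -> satisfies (doubled_boolean 3 3) e,
      forall e : lidentity,
        satisfies (permutohedron 12) e -> satisfies (doubled_boolean 3 3) e &
      forall e : lidentity,
        (forall n : nat, 0 < n -> satisfies (permutohedron n) e) ->
        satisfies (doubled_boolean 3 3) e].
Proof.
split=> e; first exact: satisfies_certificate witness_certificate.
  by move/satisfies_perm_assoc/(satisfies_certificate witness_certificate).
by move=> /(_ 12 isT)/satisfies_perm_assoc
           /(satisfies_certificate witness_certificate).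
Qed.
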